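(* Let $\Delta$ be a connected poset, $a\in\Delta$, and let $\mathcal A=(A,\jmath)_\Delta$ be a bundle of fixed-point $C^*$-algebras over $\Delta$: a $C^*$-bundle with all fibres equal to $A_\bullet=F_\bullet^G$, where $F_\bullet$ is a $C^*$-algebra and $G\subseteq\mathrm{Aut}\,F_\bullet$ a group of automorphisms. Let $NF_\bullet$ be the normalizer of $G$ in $\mathrm{Aut}\,F_\bullet$, ${}^2G=(G\to NF_\bullet)$ and $QG=NF_\bullet/G$, acting on $A_\bullet$ by *-automorphisms. Suppose that $\jmath_p\in QG$ for every loop $p:a\to a$. Then there are a twisted connection $\tau=(\upsilon,\delta)\in\check U^2(\Delta,{}^2G)$, unique up to equivalence, and an associated $C^*$-gerbe $\check{\mathcal F}_{\mathcal A}$, unique up to isomorphism, such that $\mathcal A$ is isomorphic to the fixed-point bundle of $\check{\mathcal F}_{\mathcal A}$.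
   Context: **Posets.** $\Sigma_0(\Delta)=\Delta$; for $n\ge1$ an $n$-simplex $d\in\Sigma_n(\Delta)$ is a tuple $(\partial_0d,\dots,\partial_nd;|d|)$ with $\partial_kd\in\Sigma_{n-1}(\Delta)$, $|d|\in\Delta$, $|\partial_kd|\le|d|$ (with $|o|=o$ for $o\in\Delta$) and $\partial_{hk}d=\partial_{k\,h+1}d$ for $h\ge k$, $\partial_{hk}:=\partial_h\circ\partial_k$. A 1-simplex $b=(\partial_0b,\partial_1b;|b|)$ goes from $\partial_1b$ to $\partial_0b$; reverse $\overline b=(\partial_1b,\partial_0b;|b|)$; $\iota_a=(a,a;a)$. $N_1(\Delta)\subset\Sigma_1(\Delta)$ is the set of $b$ with $\partial_1b\le\partial_0b=|b|$; $N_2(\Delta)\subset\Sigma_2(\Delta)$ consists of the simplices attached to chains $o\le\omega\le\xi$: $\partial_2c=(o\le\omega)$, $\partial_0c=(\omega\le\xi)$, $\partial_1c=(o\le\xi)$, $|c|=\xi$. A path $p=b_n*\dots*b_1:a\to o$ is a composable sequence of 1-simplices, $\overline p=\overline b_1*\dots*\overline b_n$; connected means any two elements are joined by a path. Path frame at $a$: paths $p_{oa}:a\to o$ with $p_{aa}=\iota_a$, $p_{ao}:=\overline{p_{oa}}$. **$C^*$-bundles.** A $C^*$-bundle $(A,\jmath)_\Delta$ is a family of $C^*$-algebras with *-isomorphisms $\jmath_{\omega o}:A_o\to A_\omega$ ($o\le\omega$), $\jmath_{\xi\omega}\circ\jmath_{\omega o}=\jmath_{\xi o}$; $\jmath_b:=\jmath_{|b|\partial_0b}^{-1}\circ\jmath_{|b|\partial_1b}$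 and $\jmath_p:=\jmath_{b_n}\circ\dots\circ\jmath_{b_1}$. An isomorphism is a family of *-isomorphisms $\eta_o:A_o\to A'_o$ with $\eta_\omega\circ\jmath_{\omega o}=\jmath'_{\omega o}\circ\eta_o$. Elements of $QG$ are regarded as automorphisms of $A_\bullet$ by restricting representatives in $NF_\bullet$ to $A_\bullet$; ''$\jmath_p\in QG$'' treats $QG$ as a subgroup of $\mathrm{Aut}\,A_\bullet$ in this way. **2-groups and cocycles.** A 2-group $(G\to N)$ is a pair of group morphisms $i:G\to N$, $g\mapsto\underline g$, and $N\to\mathrm{Aut}\,G$, $u\mapsto\widehat u$, with $i(\widehat u(g))=ui(g)u^{-1}$, $\widehat{i(g)}(h)=ghg^{-1}$; a normal subgroup $G\subseteq N$ gives one by inclusion and conjugation. Morphisms are pairs $(\eta_0,\eta_1)$ of group morphisms commuting with $i$ and equivariant. $\check Z^2(\Delta,{}^2G)$ is the set of pairs $q=(u,g)$, $u:\Sigma_1(\Delta)\to N$, $g:\Sigma_2(\Delta)\to G$, with $\underline{g_c}=u_{\partial_0c}u_{\partial_2c}u_{\partial_1c}^{-1}$ and $g_{\partial_0d}g_{\partial_2d}=\widehat u_{\partial_{01}d}(g_{\partial_3d})g_{\partial_1d}$. $q,q'$ are equivalent (cohomologous) if there are $v:\Sigma_0(\Delta)\to N$, $h:\Sigma_1(\Delta)\to G$ with $u'_b=\underline{h_b}v_{\partial_0b}u_bv_{\partial_1b}^{-1}$, $g'_c=\widehat{u'}_{\partial_0c}(h_{\partial_2c})h_{\partial_0c}\widehat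 v_{\partial_{01}c}(g_c)h_{\partial_1c}^{-1}$. $\check U^2(\Delta,{}^2G)$ is the set of twisted connections: cocycles with $u_{\overline b}=u_b^{-1}$ for all $b$. $\eta_*(u,g)=(\eta_1\circ u,\eta_0\circ g)$. **$C^*$-gerbes.** A bundle $C^*$-gerbe for $q=(u,g)$ is $\check{\mathcal F}=(F,\jmath)_\Delta$ with $C^*$-algebras $F_o$ carrying actions $\alpha_o:G\to\mathrm{Aut}\,F_o$ and *-isomorphisms $\jmath_b:F_{\partial_1b}\to F_{\partial_0b}$, $b\in N_1(\Delta)$, with $\alpha_{\partial_{01}c}(g_c)\circ\jmath_{\partial_1c}=\jmath_{\partial_0c}\circ\jmath_{\partial_2c}$ ($c\in N_2(\Delta)$) and $\jmath_b\circ\alpha_{\partial_1b}(g)=\alpha_{\partial_0b}(\widehat u_b(g))\circ\jmath_b$; extended to $\Sigma_1(\Delta)$ and to paths as for bundles. Its fixed-point bundle has fibres $F_o^{\alpha_o(G)}$ and structure the restrictions of $\jmath$. An isomorphism $\eta_\beta$ of gerbes is a family of $G$-equivariant *-isomorphisms $\eta_o:F_o\to F'_o$ and elements $\beta_b\in\alpha'_{\partial_0b}(G)$ with $\beta_b\circ\eta_{\partial_0b}\circ\jmath_b=\jmath'_b\circ\eta_{\partial_1b}$. With a path frame at $a$, $\jmath^{\,a}_b:=\jmath_{p_{a\,\partial_0b}*b*p_{\partial_1b\,a}}$, $\delta^a_c:=\jmath^{\,a}_{\partial_0c}\circ\jmath^{\,a}_{\partial_2c}\circ(\jmath^{\,a}_{\partial_1c})^{-1}$.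 A gerbe is associated to a twisted connection $q$ if $\alpha_a$ extends to a 2-group morphism $\alpha_a:{}^2G\to{}^2G_{a,\alpha}:=(\alpha_a(G)\to NF_a)$, with $NF_a$ the normalizer of $\alpha_a(G)$ in $\mathrm{Aut}\,F_a$, and $(\jmath^{\,a},\delta^a)$ is equivalent to $\alpha_{a,*}q$ in $\check Z^2(\Delta,{}^2G_{a,\alpha})$. In the claim, $\check{\mathcal F}_{\mathcal A}$ is a gerbe associated to $\tau$ with fibre $F_\bullet$ and the given inclusion $G\subseteq\mathrm{Aut}\,F_\bullet$ as action.
   Formalization: Both uniqueness claims, false as stated, are proved among competitors whose isomorphism from A at a lies in QG (for τ) or is restricted from a G-equivariant automorphism of F (for the gerbe, τ fixed); ''associated'' uses the identity extension NF→NF_a. QG acts faithfully on A. *)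

(* Defs.v *)
From HB Require Import structures.
From mathcomp Require Import all_boot all_order all_algebra.
From mathcomp Require Import complex.
From mathcomp Require Import boolp classical_sets reals topology normedtype.

Set Implicit Arguments.
Unset Strict Implicit.
Unset Printing Implicit Defensive.

Import Order.TTheory GRing.Theory Num.Theory.
Import numFieldNormedType.Exports.

Local Open Scope classical_set_scope.
Local Open Scope ring_scope.

(* C*-algebras are not assumed to be unital.  The norm takes its values in
   R[i], as for every normed module over R[i]; they are real. *)
HB.mixin Record CompleteNormedModule_isCStar (R : realType) A
    & CompleteNormedModule R[i] A := {
  smul : A -> A -> A;
  star : A -> A;
  smulA : associative smul;
  smulDl : left_distributive smul +%R;
  smulDr : right_distributive smul +%R;
  smulZl : forall (k : R[i]) (x y : A), smul (k *: x) y = k *: smul x y;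
  smulZr : forall (k : R[i]) (x y : A), smul x (k *: y) = k *: smul x y;
  starK : involutive star;
  starD : {morph star : x y / x + y};
  starZ : forall (k : R[i]) (x : A), star (k *: x) = k^* *: star x;
  starM : forall x y : A, star (smul x y) = smul (star y) (star x);
  norm_smul : forall x y : A, `|smul x y| <= `|x| * `|y|;
  norm_star_smul : forall x : A, `|smul (star x) x| = `|x| ^+ 2
}.

#[short(type="cstarAlgType")]
HB.structure Definition CStarAlgebra (R : realType) :=
  {A of CompleteNormedModule R[i] A & CompleteNormedModule_isCStar R A}.

(* *-isomorphisms of C*-algebras are automatically isometric.  The field
   [siso_norm] records this classical fact, which makes fixed-point algebras
   visibly closed. *)
Record star_iso (R : realType) (A B : cstarAlgType R) := StarIso {
  siso_fun :> A -> B;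
  siso_inv : B -> A;
  siso_funK : cancel siso_fun siso_inv;
  siso_invK : cancel siso_inv siso_fun;
  siso_linear : linear siso_fun;
  siso_mul : {morph siso_fun : x y / smul x y};
  siso_star : {morph siso_fun : x / star x};
  siso_norm : forall x, `|siso_fun x| = `|x|
}.

Section StarIso.
Variable R : realType.
Implicit Types A B C : cstarAlgType R.

Lemma star_iso_eq A B (f g : star_iso A B) : f =1 g -> f = g.
Proof.
case: f g => [f f' fK f'K flin fM fS fN] [g g' gK g'K glin gM gS gN] /= fg.
move/funext: fg => fg; subst g.
have f'g' : f' = g' by apply/funext => x; rewrite -[in RHS](f'K x) gK.
subst g'.
by rewrite (Prop_irrelevance fK gK) (Prop_irrelevance f'K g'K)
  (Prop_irrelevance flin glin) (Prop_irrelevance fM gM)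
  (Prop_irrelevance fS gS) (Prop_irrelevance fN gN).
Qed.

Lemma siso_inv_linear A B (f : star_iso A B) : linear (siso_inv f).
Proof.
move=> k x y; apply: (can_inj (siso_funK f)).
by rewrite siso_linear !siso_invK.
Qed.

Lemma siso_inv_mul A B (f : star_iso A B) :
  {morph siso_inv f : x y / smul x y}.
Proof.
move=> x y; apply: (can_inj (siso_funK f)).
by rewrite siso_mul !siso_invK.
Qed.

Lemma siso_inv_star A B (f : star_iso A B) : {morph siso_inv f : x / star x}.
Proof.
move=> x; apply: (can_inj (siso_funK f)).
by rewrite siso_star !siso_invK.
Qed.

Lemma siso_inv_norm A B (f : star_iso A B) x : `|siso_inv f x| = `|x|.
Proof. by rewrite -[RHS](congr1 _ (siso_invK f x)) siso_norm. Qed.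

Definition siso_id A : star_iso A A.
Proof. by apply: (@StarIso _ A A idfun idfun). Defined.

Definition siso_sym A B (f : star_iso A B) : star_iso B A :=
  StarIso (siso_invK f) (siso_funK f) (siso_inv_linear f) (siso_inv_mul f)
    (siso_inv_star f) (siso_inv_norm f).

Definition siso_comp A B C (g : star_iso B C) (f : star_iso A B) :
  star_iso A C.
Proof.
apply: (@StarIso _ A C (g \o f) (siso_inv f \o siso_inv g)).
- by move=> x /=; rewrite !siso_funK.
- by move=> x /=; rewrite !siso_invK.
- by move=> k x y /=; rewrite !siso_linear.
- by move=> x y /=; rewrite !siso_mul.
- by move=> x /=; rewrite !siso_star.
- by move=> x /=; rewrite !siso_norm.
Defined.

End StarIso.

(* The group Aut A. *)
Definition star_aut (R : realType) (A : cstarAlgType R) := star_iso A A.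

HB.instance Definition _ (R : realType) (A : cstarAlgType R) :=
  gen_eqMixin (star_aut A).
HB.instance Definition _ (R : realType) (A : cstarAlgType R) :=
  gen_choiceMixin (star_aut A).

Section StarAutGroup.
Variables (R : realType) (A : cstarAlgType R).

Definition aut_mul (f g : star_aut A) : star_aut A := siso_comp f g.
Definition aut_one : star_aut A := siso_id A.
Definition aut_inv (f : star_aut A) : star_aut A := siso_sym f.

Lemma aut_mulA : associative aut_mul.
Proof. by move=> f g h; apply: star_iso_eq. Qed.
Lemma aut_mul1 : left_id aut_one aut_mul.
Proof. by move=> f; apply: star_iso_eq. Qed.
Lemma aut_mulr1 : right_id aut_one aut_mul.
Proof. by move=> f; apply: star_iso_eq. Qed.
Lemma aut_mulV : left_inverse aut_one aut_inv aut_mul.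
Proof. by move=> f; apply: star_iso_eq => x /=; rewrite siso_funK. Qed.
Lemma aut_mulrV : right_inverse aut_one aut_inv aut_mul.
Proof. by move=> f; apply: star_iso_eq => x /=; rewrite siso_invK. Qed.

HB.instance Definition _ := isGroup.Build (star_aut A)
  aut_mulA aut_mul1 aut_mulr1 aut_mulV aut_mulrV.

End StarAutGroup.

Section FixedPoints.
Variables (R : realType) (A : cstarAlgType R) (G : Type).
Variable alpha : G -> star_aut A.

Definition fixed : {pred A} := [pred x | `[< forall g, alpha g x = x >]].

Lemma fixedP x : reflect (forall g, alpha g x = x) (x \in fixed).
Proof. exact: asboolP. Qed.

Lemma fixed_submod : submod_closed fixed.
Proof.
split=> [|k x y /fixedP hx /fixedP hy]; apply/fixedP => g.
  by have := siso_linear (alpha g) (-1) 0 0; rewrite !scaleN1r !addNr.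
by rewrite siso_linear hx hy.
Qed.
HB.instance Definition _ := GRing.isSubmodClosed.Build R[i] A fixed
  fixed_submod.

Definition fixed_alg := {x : A | x \in fixed}.
HB.instance Definition _ := SubType.on fixed_alg.
HB.instance Definition _ := [Choice of fixed_alg by <:].
HB.instance Definition _ := [SubChoice_isSubLmodule of fixed_alg by <:].

Implicit Types x y : fixed_alg.

Definition fixed_norm x : R[i] := `|val x|.

Fact fixed_normD x y : fixed_norm (x + y) <= fixed_norm x + fixed_norm y.
Proof. exact: ler_normD. Qed.
Fact fixed_normZ (k : R[i]) x : fixed_norm (k *: x) = `|k| * fixed_norm x.
Proof. exact: normrZ. Qed.
Fact fixed_norm0_eq0 x : fixed_norm x = 0 -> x = 0.
Proof. by move=> /normr0_eq0 x0; apply: val_inj. Qed.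
HB.instance Definition _ := Lmodule_isNormed.Build R[i] fixed_alg
  fixed_normD fixed_normZ fixed_norm0_eq0.

Lemma fixed_normE x : `|x| = `|val x|. Proof. by []. Qed.

Fact fixed_complete (F : set_system fixed_alg) :
  ProperFilter F -> cauchy F -> cvg F.
Proof.
move=> FF /cauchy_ballP Fc.
have vc : cauchy (val @ F : set_system A).
  apply/cauchy_ballP => e e0; have := Fc e e0.
  rewrite (near_map2 (val : fixed_alg -> A) val).
  by rewrite -!ball_normE.
have [l Fl] := (cvg_ex _).1 (cauchy_cvg _ vc).
have fl : l \in fixed.
  apply/fixedP => g; apply/eqP; rewrite -subr_eq0 -normr_le0.
  apply/ler_addgt0Pr => e e0; rewrite add0r.
  move/cvgrPdist_lt : Fl => /(_ (e / 2)); rewrite divr_gt0// => /(_ isT).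
  move=> /filter_ex[x lx].
  have gx : alpha g (val x) = val x by have /fixedP := valP x.
  have -> : alpha g l - l = alpha g (l - val x) - (l - val x).
    have -> : alpha g (l - val x) = alpha g l - alpha g (val x).
      have := siso_linear (alpha g) (-1) (val x) l.
      by rewrite !scaleN1r [- val x + l]addrC [- alpha g _ + _]addrC.
    by rewrite gx opprB addrA subrK.
  rewrite (le_trans (ler_normB _ _))// siso_norm ltW//.
  by rewrite [e]splitr ltrD.
apply/cvg_ex; exists (exist _ l fl).
apply/cvgrPdist_lt => e e0; move/cvgrPdist_lt : Fl => /(_ e e0).
exact.
Qed.
HB.instance Definition _ := Uniform_isComplete.Build fixed_alg fixed_complete.

Definition fixed_mul x y : fixed_alg.
Proof.
exists (smul (val x) (val y)); apply/fixedP => g.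
by rewrite siso_mul; have /fixedP -> := valP x; have /fixedP -> := valP y.
Defined.

Definition fixed_star x : fixed_alg.
Proof.
exists (star (val x)); apply/fixedP => g.
by rewrite siso_star; have /fixedP -> := valP x.
Defined.

Fact fixed_smulA : associative fixed_mul.
Proof. by move=> x y z; apply: val_inj; apply: smulA. Qed.
Fact fixed_smulDl : left_distributive fixed_mul +%R.
Proof. by move=> x y z; apply: val_inj; apply: smulDl. Qed.
Fact fixed_smulDr : right_distributive fixed_mul +%R.
Proof. by move=> x y z; apply: val_inj; apply: smulDr. Qed.
Fact fixed_smulZl (k : R[i]) x y : fixed_mul (k *: x) y = k *: fixed_mul x y.
Proof. by apply: val_inj; apply: smulZl. Qed.
Fact fixed_smulZr (k : R[i]) x y : fixed_mul x (k *: y) = k *: fixed_mul x y.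
Proof. by apply: val_inj; apply: smulZr. Qed.
Fact fixed_starK : involutive fixed_star.
Proof. by move=> x; apply: val_inj; apply: starK. Qed.
Fact fixed_starD : {morph fixed_star : x y / x + y}.
Proof. by move=> x y; apply: val_inj; apply: starD. Qed.
Fact fixed_starZ (k : R[i]) x : fixed_star (k *: x) = k^* *: fixed_star x.
Proof. by apply: val_inj; apply: starZ. Qed.
Fact fixed_starM x y :
  fixed_star (fixed_mul x y) = fixed_mul (fixed_star y) (fixed_star x).
Proof. by apply: val_inj; apply: starM. Qed.
Fact fixed_norm_smul x y : `|fixed_mul x y| <= `|x| * `|y|.
Proof. exact: norm_smul. Qed.
Fact fixed_norm_star_smul x : `|fixed_mul (fixed_star x) x| = `|x| ^+ 2.
Proof. exact: norm_star_smul. Qed.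

HB.instance Definition _ := CompleteNormedModule_isCStar.Build R fixed_alg
  fixed_smulA fixed_smulDl fixed_smulDr fixed_smulZl fixed_smulZr fixed_starK
  fixed_starD fixed_starZ fixed_starM fixed_norm_smul fixed_norm_star_smul.

End FixedPoints.

Section FixedRestriction.
Variables (R : realType) (A B : cstarAlgType R) (G H : Type).
Variables (alpha : G -> star_aut A) (beta : H -> star_aut B).
Variable f : star_iso A B.
Hypothesis f_fixed : forall x, x \in fixed alpha -> f x \in fixed beta.
Hypothesis inv_fixed :
  forall y, y \in fixed beta -> siso_inv f y \in fixed alpha.

Definition fixed_restr : star_iso (fixed_alg alpha) (fixed_alg beta).
Proof.
apply: (@StarIso R (fixed_alg alpha) (fixed_alg beta)
  (fun x => exist _ (f (val x)) (f_fixed (valP x)))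
  (fun y => exist _ (siso_inv f (val y)) (inv_fixed (valP y)))).
- by move=> x; apply: val_inj; apply: siso_funK.
- by move=> y; apply: val_inj; apply: siso_invK.
- by move=> k x y; apply: val_inj; apply: siso_linear.
- by move=> x y; apply: val_inj; apply: siso_mul.
- by move=> x; apply: val_inj; apply: siso_star.
- by move=> x; apply: siso_norm.
Defined.

End FixedRestriction.

Section SubGroups.
Variable T : groupType.

Section SubGroupType.
Variable K : groupClosed T.

Definition sub_group := {x : T | x \in K}.
HB.instance Definition _ := SubType.on sub_group.
HB.instance Definition _ := [Choice of sub_group by <:].

Fact sub_group_closed : group_closed K.
Proof. by split=> [|x y Kx Ky]; [exact: gpred1|exact: gpredF]. Qed.
HB.instance Definition _ :=
  SubChoice_isSubGroup.Build T (fun x => x \in K) sub_group sub_group_closed.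

End SubGroupType.

Variable K : groupClosed T.

Definition normalizer : {pred T} :=
  [pred u | `[< forall g, ((u * g * u^-1)%g \in K) = (g \in K) >]].
Definition centralizer : {pred T} :=
  [pred u | `[< forall g, g \in K -> (u * g = g * u)%g >]].

Lemma normalizerP u :
  reflect (forall g, ((u * g * u^-1)%g \in K) = (g \in K)) (u \in normalizer).
Proof. exact: asboolP. Qed.

Fact normalizer1 : (1%g : T) \in normalizer.
Proof. by apply/normalizerP => g; rewrite mul1g invg1 mulg1. Qed.
Fact normalizerM : mulg_closed normalizer.
Proof.
move=> u v /normalizerP hu /normalizerP hv; apply/normalizerP => g.
by rewrite invgM -(hv g) -(hu (v * g * v^-1)%g) !mulgA.
Qed.
Fact normalizerV : invg_closed normalizer.
Proof.
move=> u /normalizerP hu; apply/normalizerP => g.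
by rewrite -hu !mulgA mulgV mul1g invgK mulgK.
Qed.
HB.instance Definition _ := isMulClosed.Build T normalizer normalizerM.
HB.instance Definition _ := isMul1Closed.Build T normalizer normalizer1.
HB.instance Definition _ := isInvClosed.Build T normalizer normalizerV.

End SubGroups.

(* The law u |-> tg_act u is a morphism from N to Aut G: each [tg_act u] is
   multiplicative by [tg_actM] and bijective by [tg_act1] and [tg_actA]. *)
Record two_group := TwoGroup {
  tg_G : groupType;
  tg_N : groupType;
  tg_i : {multiplicative tg_G -> tg_N};
  tg_act : tg_N -> tg_G -> tg_G;
  tg_actM : forall u, {morph tg_act u : g h / (g * h)%g};
  tg_act1 : forall g, tg_act 1%g g = g;
  tg_actA : forall u v g, tg_act (u * v)%g g = tg_act u (tg_act v g);
  tg_i_act : forall u g, tg_i (tg_act u g) = (u * tg_i g * u^-1)%g;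
  tg_act_i : forall g h, tg_act (tg_i g) h = (g * h * g^-1)%g
}.

Arguments tg_i {t}.

Record two_group_mor (S T : two_group) := TwoGroupMor {
  tm_G : {multiplicative tg_G S -> tg_G T};
  tm_N : {multiplicative tg_N S -> tg_N T};
  tm_i : forall g, tg_i (tm_G g) = tm_N (tg_i g);
  tm_act : forall u g, tm_G (tg_act u g) = tg_act (tm_N u) (tm_G g)
}.

(* The 2-group (K -> N_T(K)) of a subgroup K of T. *)
Section NormalizerTwoGroup.
Variables (T : groupType) (K : groupClosed T).
Notation KT := (sub_group K).
Notation NT := (sub_group (normalizer K)).

Fact sub_normalizer (x : T) : x \in K -> x \in normalizer K.
Proof.
move=> xK; have xVK : (x^-1)%g \in K by rewrite gpredV.
apply/normalizerP => g; apply/idP/idP => [h|gK]; last by rewrite !gpredM.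
have -> : g = (x^-1 * (x * g * x^-1) * x)%g by rewrite !mulgA mulVg mul1g mulgVK.
by rewrite gpredM// gpredM.
Qed.

Definition norm_incl (x : KT) : NT := exist _ (val x) (sub_normalizer (valP x)).
Fact norm_inclM : {morph norm_incl : x y / (x * y)%g}.
Proof. by move=> x y; apply: val_inj. Qed.
HB.instance Definition _ := isMultiplicative.Build KT NT norm_incl norm_inclM.

Fact norm_act_subproof (u : NT) (x : KT) :
  (val u * val x * (val u)^-1)%g \in K.
Proof. by have /normalizerP -> := valP u; exact: valP. Qed.
Definition norm_act (u : NT) (x : KT) : KT :=
  exist _ (val u * val x * (val u)^-1)%g (norm_act_subproof u x).

Definition norm_two_group : two_group.
Proof.
apply: (@TwoGroup KT NT norm_incl norm_act).
- by move=> u g h; apply: val_inj => /=; rewrite !mulgA mulgVK.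
- by move=> g; apply: val_inj => /=; rewrite mul1g invg1 mulg1.
- by move=> u v g; apply: val_inj => /=; rewrite invgM !mulgA.
- by move=> u g; apply: val_inj.
- by move=> g h; apply: val_inj.
Defined.

End NormalizerTwoGroup.

Section ActionImage.
Variables (G T : groupType) (alpha : {multiplicative G -> T}).

Definition act_image : {pred T} := [pred x | `[< exists g, alpha g = x >]].

Lemma act_imageP x : reflect (exists g, alpha g = x) (x \in act_image).
Proof. exact: asboolP. Qed.

Lemma act_val1 : alpha 1%g = 1%g.
Proof. by apply: (@mulgI T (alpha 1%g)); rewrite -gmulfM !mulg1. Qed.
Lemma act_valV g : alpha g^-1%g = (alpha g)^-1%g.
Proof.
by apply: (@mulgI T (alpha g)); rewrite -gmulfM !mulgV act_val1.
Qed.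

Fact act_image1 : (1%g : T) \in act_image.
Proof. by apply/act_imageP; exists 1%g; rewrite act_val1. Qed.
Fact act_imageM : mulg_closed act_image.
Proof.
move=> _ _ /act_imageP[g <-] /act_imageP[h <-]; apply/act_imageP.
by exists (g * h)%g; rewrite gmulfM.
Qed.
Fact act_imageV : invg_closed act_image.
Proof.
by move=> _ /act_imageP[g <-]; apply/act_imageP; exists g^-1%g; rewrite act_valV.
Qed.
HB.instance Definition _ := isMulClosed.Build T act_image act_imageM.
HB.instance Definition _ := isMul1Closed.Build T act_image act_image1.
HB.instance Definition _ := isInvClosed.Build T act_image act_imageV.

End ActionImage.

Section Inclusion.
Variables (T : groupType) (K : groupClosed T).

Definition incl (x : sub_group K) : T := val x.
Fact inclM : {morph incl : x y / (x * y)%g}.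
Proof. by []. Qed.
HB.instance Definition _ :=
  isMultiplicative.Build (sub_group K) T incl inclM.

Lemma act_image_incl x : (x \in act_image incl) = (x \in K).
Proof.
apply/act_imageP/idP => [[g <-]|xK]; first exact: valP.
by exists (exist _ x xK).
Qed.

(* The identity of the 2-group (K -> N(K)), with K seen as the image of its
   own inclusion. *)
Fact incl_ext_G_subproof (g : sub_group K) : val g \in act_image incl.
Proof. by rewrite act_image_incl (valP g). Qed.
Definition incl_ext_G (g : sub_group K) : sub_group (act_image incl) :=
  exist _ (val g) (incl_ext_G_subproof g).
Fact incl_ext_N_subproof (u : sub_group (normalizer K)) :
  val u \in normalizer (act_image incl).
Proof.
apply/normalizerP => g; rewrite !act_image_incl.
by have /normalizerP := valP u.
Qed.
Definition incl_ext_N (u : sub_group (normalizer K)) :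
    sub_group (normalizer (act_image incl)) :=
  exist _ (val u) (incl_ext_N_subproof u).

Fact incl_ext_GM : {morph incl_ext_G : x y / (x * y)%g}.
Proof. by move=> x y; apply: val_inj. Qed.
HB.instance Definition _ := isMultiplicative.Build _ _ incl_ext_G incl_ext_GM.
Fact incl_ext_NM : {morph incl_ext_N : x y / (x * y)%g}.
Proof. by move=> x y; apply: val_inj. Qed.
HB.instance Definition _ := isMultiplicative.Build _ _ incl_ext_N incl_ext_NM.

Definition incl_ext :
  two_group_mor (norm_two_group K) (norm_two_group (act_image incl)).
Proof.
apply: (@TwoGroupMor (norm_two_group K) (norm_two_group (act_image incl))
  incl_ext_G incl_ext_N).
- by move=> g; apply: val_inj.
- by move=> u g; apply: val_inj.
Defined.

End Inclusion.

Section Poset.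
Variables (disp : Order.disp_t) (Delta : porderType disp).
Implicit Types a o w x : Delta.

(* Sigma_1, Sigma_2, Sigma_3: only simplices of dimension at most 3 enter
   cocycles.  [sn_dk] is the k-th face, [sn_supp] the support, and
   [sn_id_hk] is the identity d_h d_k = d_k d_{h+1} (h >= k). *)
Record simplex1 := Simplex1 {
  s1_d0 : Delta;
  s1_d1 : Delta;
  s1_supp : Delta;
  s1_le0 : (s1_d0 <= s1_supp)%O;
  s1_le1 : (s1_d1 <= s1_supp)%O
}.

Record simplex2 := Simplex2 {
  s2_d0 : simplex1;
  s2_d1 : simplex1;
  s2_d2 : simplex1;
  s2_supp : Delta;
  s2_le0 : (s1_supp s2_d0 <= s2_supp)%O;
  s2_le1 : (s1_supp s2_d1 <= s2_supp)%O;
  s2_le2 : (s1_supp s2_d2 <= s2_supp)%O;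
  s2_id_00 : s1_d0 s2_d0 = s1_d0 s2_d1;
  s2_id_10 : s1_d1 s2_d0 = s1_d0 s2_d2;
  s2_id_11 : s1_d1 s2_d1 = s1_d1 s2_d2
}.

Record simplex3 := Simplex3 {
  s3_d0 : simplex2;
  s3_d1 : simplex2;
  s3_d2 : simplex2;
  s3_d3 : simplex2;
  s3_supp : Delta;
  s3_le0 : (s2_supp s3_d0 <= s3_supp)%O;
  s3_le1 : (s2_supp s3_d1 <= s3_supp)%O;
  s3_le2 : (s2_supp s3_d2 <= s3_supp)%O;
  s3_le3 : (s2_supp s3_d3 <= s3_supp)%O;
  s3_id_00 : s2_d0 s3_d0 = s2_d0 s3_d1;
  s3_id_10 : s2_d1 s3_d0 = s2_d0 s3_d2;
  s3_id_20 : s2_d2 s3_d0 = s2_d0 s3_d3;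
  s3_id_11 : s2_d1 s3_d1 = s2_d1 s3_d2;
  s3_id_21 : s2_d2 s3_d1 = s2_d1 s3_d3;
  s3_id_22 : s2_d2 s3_d2 = s2_d2 s3_d3
}.

Definition rev1 (b : simplex1) : simplex1 := Simplex1 (s1_le1 b) (s1_le0 b).
Definition iota a : simplex1 := Simplex1 (lexx a) (lexx a).

Definition is_nerve1 (b : simplex1) : Prop :=
  (s1_d1 b <= s1_d0 b)%O /\ s1_d0 b = s1_supp b.

(* The simplices of N_1 and N_2 attached to o <= w and o <= w <= x. *)
Definition nerve1 o w (h : (o <= w)%O) : simplex1 := Simplex1 (lexx w) h.
Definition nerve2 o w x (h : (o <= w)%O) (k : (w <= x)%O) : simplex2 :=
  @Simplex2 (nerve1 k) (nerve1 (le_trans h k)) (nerve1 h) x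
    (lexx x) (lexx x) k erefl erefl erefl.

(* [path_cons b p] is b * p: paths are composed from right to left. *)
Inductive poset_path : Delta -> Delta -> Type :=
| path_one b : poset_path (s1_d1 b) (s1_d0 b)
| path_cons a b : poset_path a (s1_d1 b) -> poset_path a (s1_d0 b).

Fixpoint path_cat a o w (p : poset_path o w) :
    poset_path a o -> poset_path a w :=
  match p in poset_path o' w' return poset_path a o' -> poset_path a w' with
  | path_one b => fun q => path_cons q
  | path_cons _ b p' => fun q => path_cons (path_cat p' q)
  end.

Fixpoint path_rev a o (p : poset_path a o) : poset_path o a :=
  match p in poset_path a' o' return poset_path o' a' with
  | path_one b => path_one (rev1 b)
  | path_cons _ b p' => path_cat (path_rev p') (path_one (rev1 b))
  end.

Definition poset_connected : Prop := forall a o, inhabited (poset_path a o).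

Record path_frame a := PathFrame {
  pf_path :> forall o, poset_path a o;
  pf_base : pf_path a = path_one (iota a)
}.

Definition frame_loop a (p : path_frame a) (b : simplex1) : poset_path a a :=
  path_cat (path_rev (p (s1_d0 b))) (path_cons (p (s1_d1 b))).

Section Cochains.
Implicit Types T : two_group.

Record cochain T := Cochain {
  ch_u : simplex1 -> tg_N T;
  ch_g : simplex2 -> tg_G T
}.

Definition cocycle T (q : cochain T) : Prop :=
  (forall c, tg_i (ch_g q c) =
     (ch_u q (s2_d0 c) * ch_u q (s2_d2 c) * (ch_u q (s2_d1 c))^-1)%g) /\
  (forall d, (ch_g q (s3_d0 d) * ch_g q (s3_d2 d))%g =
     (tg_act (ch_u q (s2_d0 (s3_d1 d))) (ch_g q (s3_d3 d))
        * ch_g q (s3_d1 d))%g).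

Definition twisted_connection T (q : cochain T) : Prop :=
  cocycle q /\ forall b, ch_u q (rev1 b) = (ch_u q b)^-1%g.

Definition cohomologous T (q q' : cochain T) : Prop :=
  exists (v : Delta -> tg_N T) (h : simplex1 -> tg_G T),
    (forall b, ch_u q' b =
       (tg_i (h b) * v (s1_d0 b) * ch_u q b * (v (s1_d1 b))^-1)%g) /\
    (forall c, ch_g q' c =
       (tg_act (ch_u q' (s2_d0 c)) (h (s2_d2 c)) * h (s2_d0 c)
          * tg_act (v (s1_d0 (s2_d1 c))) (ch_g q c) * (h (s2_d1 c))^-1)%g).

Definition push S T (eta : two_group_mor S T) (q : cochain S) : cochain T :=
  Cochain (tm_N eta \o ch_u q) (tm_G eta \o ch_g q).

End Cochains.

Section Bundles.
Variable R : realType.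

Fixpoint path_transport (A : Delta -> cstarAlgType R)
    (j : forall b, star_iso (A (s1_d1 b)) (A (s1_d0 b)))
    a o (p : poset_path a o) : star_iso (A a) (A o) :=
  match p in poset_path a' o' return star_iso (A a') (A o') with
  | path_one b => j b
  | path_cons _ b p' => siso_comp (j b) (path_transport j p')
  end.

Record cstar_bundle (A : Delta -> cstarAlgType R) := CStarBundle {
  bj : forall o w, (o <= w)%O -> star_iso (A o) (A w);
  bj_comp : forall o w x (h : (o <= w)%O) (k : (w <= x)%O) (l : (o <= x)%O) y,
    bj k (bj h y) = bj l y
}.

Definition bundle_j (A : Delta -> cstarAlgType R) (B : cstar_bundle A)
    (b : simplex1) : star_iso (A (s1_d1 b)) (A (s1_d0 b)) :=
  siso_comp (siso_sym (bj B (s1_le0 b))) (bj B (s1_le1 b)).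

Definition bundle_iso (A A' : Delta -> cstarAlgType R)
    (B : cstar_bundle A) (B' : cstar_bundle A')
    (eta : forall o, star_iso (A o) (A' o)) : Prop :=
  forall o w (h : (o <= w)%O) y, eta w (bj B h y) = bj B' h (eta o y).

Section Gerbes.
Variables (T : two_group) (q : cochain T).
Variable F : Delta -> cstarAlgType R.
Variable alpha : forall o, {multiplicative tg_G T -> star_aut (F o)}.

(* A bundle C*-gerbe for q with fibres F_o and actions alpha_o.  N_1 and N_2
   are indexed by the chains o <= w and o <= w <= x. *)
Record gerbe := Gerbe {
  gj : forall o w, (o <= w)%O -> star_iso (F o) (F w);
  gj_comp : forall o w x (h : (o <= w)%O) (k : (w <= x)%O) y,
    alpha x (ch_g q (nerve2 h k)) (gj (le_trans h k) y) = gj k (gj h y);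
  gj_act : forall o w (h : (o <= w)%O) g y,
    gj h (alpha o g y) = alpha w (tg_act (ch_u q (nerve1 h)) g) (gj h y)
}.

Variable E : gerbe.

(* On N_1 this is the given isomorphism: the formula used outside N_1 would
   alter it there by gj (lexx _)^-1, which lies in the image of the action but
   need not be the identity. *)
Definition gerbe_j (b : simplex1) : star_iso (F (s1_d1 b)) (F (s1_d0 b)) :=
  match pselect (is_nerve1 b) with
  | left h => gj E h.1
  | right _ => siso_comp (siso_sym (gj E (s1_le0 b))) (gj E (s1_le1 b))
  end.

Section Based.
Variables (a : Delta) (p : path_frame a).

Definition based_j (b : simplex1) : star_aut (F a) :=
  path_transport gerbe_j (frame_loop p b).

Definition based_delta (c : simplex2) : star_aut (F a) :=
  (based_j (s2_d0 c) * based_j (s2_d2 c) * (based_j (s2_d1 c))^-1)%g.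

End Based.

(* [ext] is the extension of alpha_a to a morphism of 2-groups; [q'] is the
   pair (j^a, delta^a), with values in alpha_a(G) -> NF_a. *)
Definition associated (a : Delta)
    (ext : two_group_mor T (norm_two_group (act_image (alpha a)))) : Prop :=
  (forall g, val (tm_G ext g) = alpha a g) /\
  exists (p : path_frame a)
         (q' : cochain (norm_two_group (act_image (alpha a)))),
    [/\ forall b, val (ch_u q' b) = based_j p b,
        forall c, val (ch_g q' c) = based_delta p c,
        cocycle q', cocycle (push ext q) & cohomologous q' (push ext q)].

Fact gj_fixed o w (h : (o <= w)%O) (y : F o) :
  y \in fixed (alpha o) -> gj E h y \in fixed (alpha w).
Proof.
move=> /fixedP yf; apply/fixedP => g.
set u := ch_u q (nerve1 h).
have -> : g = tg_act u (tg_act u^-1%g g) by rewrite -tg_actA mulgV tg_act1.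
by rewrite -gj_act yf.
Qed.

Fact gj_inv_fixed o w (h : (o <= w)%O) (z : F w) :
  z \in fixed (alpha w) -> siso_inv (gj E h) z \in fixed (alpha o).
Proof.
move=> /fixedP zf; apply/fixedP => g.
by apply: (can_inj (siso_funK (gj E h))); rewrite gj_act siso_invK zf.
Qed.

Definition fixed_bundle_j o w (h : (o <= w)%O) :
    star_iso (fixed_alg (alpha o)) (fixed_alg (alpha w)) :=
  fixed_restr (@gj_fixed o w h) (@gj_inv_fixed o w h).

Fact fixed_bundle_comp o w x (h : (o <= w)%O) (k : (w <= x)%O) (l : (o <= x)%O)
    (y : fixed_alg (alpha o)) :
  fixed_bundle_j k (fixed_bundle_j h y) = fixed_bundle_j l y.
Proof.
apply: val_inj => /=; rewrite -gj_comp (bool_irrelevance (le_trans h k) l).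
by have /fixedP := gj_fixed l (valP y); apply.
Qed.

Definition fixed_bundle :
    cstar_bundle (fun o => fixed_alg (alpha o) : cstarAlgType R) :=
  @CStarBundle (fun o => fixed_alg (alpha o) : cstarAlgType R)
    fixed_bundle_j fixed_bundle_comp.

End Gerbes.

Definition gerbe_iso (T : two_group) (q q' : cochain T)
    (F F' : Delta -> cstarAlgType R)
    (alpha : forall o, {multiplicative tg_G T -> star_aut (F o)})
    (alpha' : forall o, {multiplicative tg_G T -> star_aut (F' o)})
    (E : gerbe q alpha) (E' : gerbe q' alpha') : Prop :=
  exists (eta : forall o, star_iso (F o) (F' o))
         (beta : forall o w, (o <= w)%O -> star_aut (F' w)),
    [/\ forall o g y, eta o (alpha o g y) = alpha' o g (eta o y),
        forall o w (h : (o <= w)%O), beta o w h \in act_image (alpha' w) &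
        forall o w (h : (o <= w)%O) y,
          beta o w h (eta w (gj E h y)) = gj E' h (eta o y)].

End Bundles.
End Poset.

Section FixedPointBundles.
Variables (R : realType) (disp : Order.disp_t) (Delta : porderType disp).
Variables (F : cstarAlgType R) (G : groupClosed (star_aut F)).

Definition FG : cstarAlgType R := fixed_alg (incl (K := G)).

Definition restricts (u : star_aut F) (f : star_aut FG) : Prop :=
  forall y : FG, val (f y) = u (val y).

(* f lies in the image of QG = N(G)/G in Aut F^G. *)
Definition in_QG (f : star_aut FG) : Prop :=
  exists2 u, u \in normalizer G & restricts u f.

(* The restriction QG -> Aut F^G is injective. *)
Definition QG_faithful : Prop :=
  forall u, u \in normalizer G -> restricts u 1%g -> u \in G.

Definition const_alg : Delta -> cstarAlgType R := fun=> F.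
Definition const_incl (o : Delta) :
  {multiplicative tg_G (norm_two_group G) -> star_aut (const_alg o)} :=
  incl (K := G).

(* Isomorphism of bundles with fibre F^G whose component at a is the
   restriction of an automorphism in S: for S = N(G) that component lies in QG,
   for S = C(G) it comes from a G-equivariant automorphism of F.  The condition
   at a matters for uniqueness: an isomorphism whose component at a lies outside
   QG may conjugate the holonomy of B into another morphism to QG which is not
   conjugate to it within QG. *)
Definition bundle_iso_at (a : Delta) (S : {pred star_aut F})
    (B B' : cstar_bundle (fun _ : Delta => FG)) : Prop :=
  exists eta : forall o : Delta, star_aut FG,
    bundle_iso B B' eta /\ exists2 u, u \in S & restricts u (eta a).

End FixedPointBundles.

(* Main.v *)
(* Everything is read through restriction to the fixed-point algebra: by
   faithfulness of QG, two elements of N(G) with the same restriction to F^G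
   differ by an element of G, and a cochain with values in G -> N(G) is, up to
   equivalence, its N-component modulo G.

   Existence: fix a path frame at a.  The holonomies of A along the frame loops
   are lifted to u_b in N(G), with u_(rev b) = u_b^-1; they form a cocycle modulo
   G, hence a cocycle tau, and the u_b themselves on the nerve form the gerbe.
   The transports of A along the frame identify A with its fixed-point bundle.

   Uniqueness: an isomorphism from A to the fixed-point bundle of a gerbe
   determines the restrictions of all its transports.  For two gerbes over tau
   with transports U_o, W_o along the frame, eta_o := W_o z U_o^-1 (with z central
   relative to G) intertwines them modulo G, and it commutes with G because U_o
   and W_o act on G in the same way.  For another connection tau', changing the
   frame and the isomorphism at a conjugates the holonomies by elements of
   N(G). *)
Require Import Defs.
From mathcomp Require Import all_boot all_order all_algebra.
From mathcomp Require Import boolp classical_sets reals.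

Set Implicit Arguments.
Unset Strict Implicit.
Unset Printing Implicit Defensive.

(** * Normalizers and centralizers of a subgroup *)

Section Normalizers.
Variables (T : groupType) (K : groupClosed T).

Lemma normalizer_conj u x :
  u \in normalizer K -> x \in K -> (u * x * u^-1)%g \in K.
Proof. by move=> /normalizerP ->. Qed.

Lemma centralizer_normalizer c : c \in centralizer K -> c \in normalizer K.
Proof.
move=> /asboolP cK; apply/normalizerP => g; apply/idP/idP => gK.
  suff <- : (c * g * c^-1)%g = g by [].
  by apply: (mulgI c); rewrite cK// mulgVK.
by rewrite cK// mulgK.
Qed.

End Normalizers.

(** * Cochains with values in the 2-group of a subgroup and its normalizer *)

Section NormalizerCochains.
Variables (disp : Order.disp_t) (Delta : porderType disp).
Variables (T : groupType) (K : groupClosed T).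
Implicit Types (b : simplex1 Delta) (c : simplex2 Delta).
Implicit Types q : cochain Delta (norm_two_group K).

Let grpE := (@mulgA T, @invgM T, @invgK T, @mulgK T, @mulgVK T, @mulgV T,
  @mulVg T, @mul1g T, @mulg1 T).

Lemma cocycle_g q c : cocycle q ->
  val (ch_g q c) = (val (ch_u q (s2_d0 c)) * val (ch_u q (s2_d2 c))
                    * (val (ch_u q (s2_d1 c)))^-1)%g.
Proof. by move=> [/(_ c)/(congr1 val)]. Qed.

(* As K -> N(K) is injective, the identity on 3-simplices is automatic. *)
Lemma norm_cocycle q :
    (forall c, val (ch_g q c) =
      (val (ch_u q (s2_d0 c)) * val (ch_u q (s2_d2 c))
        * (val (ch_u q (s2_d1 c)))^-1)%g) ->
  cocycle q.
Proof.
move=> qE; split=> [c|d]; apply: val_inj; first exact: qE.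
rewrite /= !qE -(s3_id_00 d) -(s3_id_10 d) -(s3_id_20 d) -(s3_id_11 d).
by rewrite -(s3_id_21 d) -(s3_id_22 d) !grpE.
Qed.

(** The 2-components of cocycles are determined by their 1-components, so only the relation on
    1-simplices has content; it forces [h b] to be the quotient assumed to lie in [K]. *)
Lemma norm_cohomologous q q' (v : Delta -> T) :
    cocycle q -> cocycle q' -> (forall o, v o \in normalizer K) ->
    (forall b, (val (ch_u q' b) *
      (v (s1_d0 b) * val (ch_u q b) * (v (s1_d1 b))^-1)^-1)%g \in K) ->
  cohomologous q q'.
Proof.
move=> qc q'c vN hK.
exists (fun o => exist _ (v o) (vN o)), (fun b => exist (fun x => x \in K) _ (hK b)).
split=> [b|c]; apply: val_inj; first by rewrite /= !grpE.
rewrite /= !cocycle_g// -(s2_id_00 c) (s2_id_10 c) (s2_id_11 c).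
by rewrite !grpE.
Qed.

Section Construction.
Variable u : simplex1 Delta -> T.
Hypothesis uN : forall b, u b \in normalizer K.
Hypothesis uK : forall c, (u (s2_d0 c) * u (s2_d2 c) * (u (s2_d1 c))^-1)%g \in K.

Definition norm_cochain : cochain Delta (norm_two_group K) :=
  @Cochain disp Delta (norm_two_group K)
    (fun b => exist _ (u b) (uN b)) (fun c => exist (fun x => x \in K) _ (uK c)).

Lemma norm_cochain_cocycle : cocycle norm_cochain.
Proof. by apply: norm_cocycle => c. Qed.

End Construction.

End NormalizerCochains.

Lemma push_incl_cocycle (disp : Order.disp_t) (Delta : porderType disp)
    (T : groupType) (K : groupClosed T)
    (q : cochain Delta (norm_two_group K)) :
  cocycle q -> cocycle (push (incl_ext K) q).
Proof.
move=> qc; apply: norm_cocycle => c.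
exact: (cocycle_g c qc).
Qed.

(** * Choices compatible with the reversal of 1-simplices *)

Section Simplices.
Variables (disp : Order.disp_t) (Delta : porderType disp).
Implicit Types b : simplex1 Delta.

Lemma rev1K : involutive (@rev1 disp Delta).
Proof. by case. Qed.

Lemma rev1_fixed b : rev1 b = b -> s1_d0 b = s1_d1 b.
Proof. by move=> /(congr1 (@s1_d1 _ _)). Qed.

(** This yields lifts with [u (rev1 b)] inverse to [u b], as a twisted connection requires. A value
    is chosen on one simplex of each reversal pair and inverted on the other; a simplex equal to its
    reverse gets [1], which is its own inverse. *)
Lemma odd_choice (T : groupType) (P : simplex1 Delta -> T -> Prop) :
    (forall b x, P b x -> P (rev1 b) x^-1%g) ->
    (forall b, rev1 b = b -> P b 1%g) ->
    (forall b, exists x, P b x) ->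
  exists u, (forall b, P b (u b)) /\ forall b, u (rev1 b) = (u b)^-1%g.
Proof.
move=> PV P1 Pex.
have [u0 Pu0] := choice Pex.
(* [s] picks one simplex from each pair [{b, rev1 b}]. *)
pose pair b : simplex1 Delta -> Prop := fun b' => b' = b \/ b' = rev1 b.
have pairV b : pair (rev1 b) = pair b.
  by apply/funext => b'; rewrite /pair rev1K; apply/propext; split=> -[]; auto.
have pairx b : exists b', pair b b' by exists b; left.
(* The choice is made from the pair as a set. By extensionality that set is the same for [b] and
   [rev1 b], hence so is the chosen simplex. *)
have [s0 s0P] := choice (fun S : {S : simplex1 Delta -> Prop | exists b, S b} =>
  proj2_sig S).
pose s b := s0 (exist _ (pair b) (pairx b)).
have sP b : s b = b \/ s b = rev1 b by apply: (s0P (exist _ _ (pairx b))).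
have sV b : s (rev1 b) = s b by congr s0; exact: eq_exist.
exists (fun b => if `[< rev1 b = b >] then 1%g else
                 if `[< s b = b >] then u0 b else (u0 (rev1 b))^-1%g).
split=> b.
  case: asboolP => [/P1//|_]; case: asboolP => [//|_].
  by rewrite -[X in P X](rev1K b); apply: PV.
rewrite sV rev1K; case: (asboolP (b = rev1 b)) => bV.
  by rewrite -bV asboolT// invg1.
have Vb : rev1 b <> b by move=> /esym.
rewrite (asboolF Vb); case: (sP b) => ->.
  by rewrite (asboolF bV) asboolT.
by rewrite asboolT// (asboolF Vb) invgK.
Qed.

End Simplices.

(** * Transport along paths, in bundles and in general *)

Section Transport.
Import Order.TTheory.
Variables (disp : Order.disp_t) (Delta : porderType disp) (R : realType).
Implicit Types A B : Delta -> cstarAlgType R.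

(** One induction on paths serves for membership in N(G), for comparing two gerbes over the same
    cochain, and for comparing a gerbe with a bundle. *)
Lemma path_transport_rel A B
    (j : forall b, star_iso (A (s1_d1 b)) (A (s1_d0 b)))
    (k : forall b, star_iso (B (s1_d1 b)) (B (s1_d0 b)))
    (P : forall o w, star_iso (A o) (A w) -> star_iso (B o) (B w) -> Prop) :
    (forall o w x f f' g g', P o w f f' -> P w x g g' ->
       P o x (siso_comp g f) (siso_comp g' f')) ->
    (forall b, P _ _ (j b) (k b)) ->
  forall o w (p : poset_path o w), P _ _ (path_transport j p) (path_transport k p).
Proof.
move=> Pcomp Pj o w; elim=> [b|a' b p IHp] /=; first exact: Pj.
exact: Pcomp IHp (Pj b).
Qed.

Lemma path_transport_cat A
    (j : forall b, star_iso (A (s1_d1 b)) (A (s1_d0 b)))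
    a o w (p : poset_path o w) (q : poset_path a o) :
  path_transport j (path_cat p q) =
  siso_comp (path_transport j p) (path_transport j q).
Proof.
elim: p q => [b|a' b p IHp] q //=.
by rewrite IHp; apply: star_iso_eq.
Qed.

Lemma bj_refl A (B : cstar_bundle A) o (h : (o <= o)%O) y : bj B h y = y.
Proof. by apply: (can_inj (siso_funK (bj B h))); apply: bj_comp. Qed.

Lemma bundle_j_rev A (B : cstar_bundle A) b :
  bundle_j B (rev1 b) = siso_sym (bundle_j B b).
Proof. exact: star_iso_eq. Qed.

Lemma bundle_transport_rev A (B : cstar_bundle A) a o (p : poset_path a o) :
  path_transport (bundle_j B) (path_rev p) =
  siso_sym (path_transport (bundle_j B) p).
Proof.
elim: p => [b|a' b p IHp] /=; first exact: bundle_j_rev.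
by rewrite path_transport_cat IHp /= bundle_j_rev; apply: star_iso_eq.
Qed.

(** All three simplices lie below [s], and after pushing everything into the fibre at [s] each
    [bundle_j] cancels. Vertices and supports are spelled out so that the maps compose without casts
    along face identities. *)
Lemma bundle_j_cocycle A (B : cstar_bundle A) o w x s0 s1 s2 s
    (h00 : (x <= s0)%O) (h01 : (w <= s0)%O)
    (h10 : (x <= s1)%O) (h11 : (o <= s1)%O)
    (h20 : (w <= s2)%O) (h21 : (o <= s2)%O)
    (k0 : (s0 <= s)%O) (k1 : (s1 <= s)%O) (k2 : (s2 <= s)%O) y :
  bundle_j B (Simplex1 h00 h01) (bundle_j B (Simplex1 h20 h21) y) =
  bundle_j B (Simplex1 h10 h11) y.
Proof.
have jE o' w' t (h0 : (w' <= t)%O) (h1 : (o' <= t)%O) (k : (t <= s)%O) z :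
    bj B (le_trans h0 k) (bundle_j B (Simplex1 h0 h1) z) =
    bj B (le_trans h1 k) z.
  by rewrite -(bj_comp B h0 k) -(bj_comp B h1 k) /= siso_invK.
apply: (can_inj (siso_funK (bj B (le_trans h00 k0)))).
rewrite jE (bool_irrelevance (le_trans h01 k0) (le_trans h20 k2)) jE.
rewrite (bool_irrelevance (le_trans h00 k0) (le_trans h10 k1)) jE.
by rewrite (bool_irrelevance (le_trans h21 k2) (le_trans h11 k1)).
Qed.

Lemma path_frame_exists (a : Delta) :
  poset_connected Delta -> inhabited (path_frame a).
Proof.
move=> conn.
have cf o : {p : poset_path a o | True} by apply: cid; case: (conn a o) => p; exists p.
(* The chosen path at [a] is replaced by [iota a], as a frame demands; the cast along [a = a] is
   trivial by proof irrelevance. *)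
pose g o : poset_path a o :=
  match pselect (a = o) with
  | left e =>
      match e in _ = x return poset_path a x with
      | erefl => path_one (Defs.iota a)
      end
  | right _ => sval (cf o)
  end.
have ga : g a = path_one (Defs.iota a).
  rewrite /g; by case: pselect => // e; rewrite (Prop_irrelevance e (erefl a)).
exact: inhabits (PathFrame ga).
Qed.

End Transport.

(** * Restriction of automorphisms to the fixed-point algebra *)

Section Restrictions.
Variables (R : realType) (F : cstarAlgType R) (G : groupClosed (star_aut F)).
Notation FG := (FG G).
Implicit Types (u v : star_aut F) (f g : star_aut FG).

Lemma restrictsM u v f g :
  restricts u f -> restricts v g -> restricts (u * v)%g (f * g)%g.
Proof. by move=> uf vg y; rewrite /= uf vg. Qed.

Lemma restrictsV u f : restricts u f -> restricts u^-1%g f^-1%g.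
Proof.
move=> uf y; apply: (can_inj (siso_funK u)).
by rewrite -uf (siso_invK f) (siso_invK u).
Qed.

Lemma restricts_sub u : u \in G -> restricts u (1%g : star_aut FG).
Proof.
move=> uG y; have /fixedP/(_ (exist (fun x => x \in G) u uG)) := valP y.
by move=> /esym.
Qed.

(** For g in G, g u = u (u^-1 g u), and u^-1 g u lies in G, so it fixes y. *)
Lemma normalizer_fixed u : u \in normalizer G ->
  forall y, y \in fixed (incl (K := G)) -> u y \in fixed (incl (K := G)).
Proof.
move=> uN y /fixedP yf; apply/fixedP => g.
have gG : (u^-1 * val g * u)%g \in G.
  have uVN : u^-1%g \in normalizer G by rewrite gpredV.
  by have /normalizerP/(_ (val g)) := uVN; rewrite invgK (valP g).
have guy : siso_inv u (val g (u y)) = y by apply: yf (exist (fun x => x \in G) _ gG).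
by rewrite -[in RHS]guy siso_invK.
Qed.

Lemma normalizer_restricts u : u \in normalizer G ->
  exists f, restricts u f.
Proof.
move=> uN; have uVN : u^-1%g \in normalizer G by rewrite gpredV.
by exists (fixed_restr (normalizer_fixed uN) (normalizer_fixed uVN)).
Qed.

Hypothesis hQG : QG_faithful G.

(** Faithfulness of QG acts through this lemma alone: it turns equal restrictions into equality
    modulo G. *)
Lemma restricts_eq_mod u v f : u \in normalizer G -> v \in normalizer G ->
  restricts u f -> restricts v f -> (u * v^-1)%g \in G.
Proof.
move=> uN vN uf vf; apply: hQG; first by rewrite gpredM// gpredV.
by have := restrictsM uf (restrictsV vf); rewrite mulgV.
Qed.

End Restrictions.

(** * Gerbes with constant fibre: transports as elements of N(G) *)

Section NormalizerGerbes.
Variables (R : realType) (disp : Order.disp_t) (Delta : porderType disp).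
Variables (F : cstarAlgType R) (G : groupClosed (star_aut F)).

Section Gerbe.
Variables (tau : cochain Delta (norm_two_group G)).
Variable E : gerbe tau (@const_incl R disp Delta F G).

Definition gj_aut o w (h : (o <= w)%O) : star_aut F := gj E h.
Definition gerbe_j_aut b : star_aut F := gerbe_j E b.
Definition gerbe_transport o w (p : poset_path o w) : star_aut F :=
  path_transport (gerbe_j E) p.

Lemma gj_conj o w (h : (o <= w)%O) x : x \in G ->
  (gj_aut h * x = val (ch_u tau (nerve1 h)) * x
                  * (val (ch_u tau (nerve1 h)))^-1 * gj_aut h)%g.
Proof.
move=> xG; apply: star_iso_eq => y.
exact: (gj_act E h (exist (fun x => x \in G) x xG) y).
Qed.

(** Equivariance says that the gerbe map and the value of [tau] conjugate G in the same way, so they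
    differ by a factor centralizing G. This places the gerbe map in N(G). *)
Lemma gj_centralizer o w (h : (o <= w)%O) :
  ((val (ch_u tau (nerve1 h)))^-1 * gj_aut h)%g \in centralizer G.
Proof.
by apply/asboolP => x xG; rewrite -mulgA gj_conj// !mulgA mulVg mul1g.
Qed.

Lemma gj_normalizer o w (h : (o <= w)%O) : gj_aut h \in normalizer G.
Proof.
have := centralizer_normalizer (gj_centralizer h).
by rewrite gpredMl// gpredV; apply: valP.
Qed.

Lemma gerbe_j_normalizer b : gerbe_j_aut b \in normalizer G.
Proof.
rewrite /gerbe_j_aut /gerbe_j; case: pselect => [h|_]; first exact: gj_normalizer.
apply: (@gpredM _ (normalizer G) (gj_aut (s1_le0 b))^-1%g (gj_aut (s1_le1 b))).
  by rewrite gpredV gj_normalizer.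
exact: gj_normalizer.
Qed.

Lemma gerbe_transport_normalizer o w (p : poset_path o w) :
  gerbe_transport p \in normalizer G.
Proof.
apply: (@path_transport_rel disp Delta R (fun=> F) (fun=> F)
  gerbe_j_aut gerbe_j_aut (fun _ _ f _ => f \in normalizer G)).
  by move=> o' w' x f _ g _ fN gN; apply: (@gpredM _ (normalizer G) g f).
exact: gerbe_j_normalizer.
Qed.

Section BundleIso.
Variable A : cstar_bundle (fun _ : Delta => FG G).
Variable eta : Delta -> star_aut (FG G).
Hypothesis etaP : bundle_iso A (fixed_bundle E) eta.

Lemma gj_restricts o w (h : (o <= w)%O) :
  restricts (gj_aut h) (eta w * (bj A h : star_aut (FG G)) * (eta o)^-1)%g.
Proof. by move=> y; rewrite /= etaP siso_invK. Qed.

Lemma gerbe_j_restricts b :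
  restricts (gerbe_j_aut b)
    (eta (s1_d0 b) * (bundle_j A b : star_aut (FG G)) * (eta (s1_d1 b))^-1)%g.
Proof.
rewrite /gerbe_j_aut /gerbe_j; case: pselect => [h|_] y.
  (* On the nerve the support is [d0], so the inverted factor of [bundle_j] is the identity and only
     the map along [h] remains. *)
  case: b h => d0 d1 s le0 le1 /= [/= h e]; subst s.
  rewrite -gj_restricts /= (bool_irrelevance le1 h); congr (val (eta d0 _)).
  apply: (can_inj (siso_funK (bj A le0))).
  by rewrite siso_invK bj_refl (bool_irrelevance (proj1 _) h).
have := restrictsM (restrictsV (gj_restricts (s1_le0 b)))
  (gj_restricts (s1_le1 b)) y.
move=> <-; congr (val _).
by rewrite !invgM !invgK !mulgA mulgVK.
Qed.

Lemma gerbe_transport_restricts o w (p : poset_path o w) :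
  restricts (gerbe_transport p)
    (eta w * (path_transport (bundle_j A) p : star_aut (FG G)) * (eta o)^-1)%g.
Proof.
apply: (@path_transport_rel disp Delta R (fun=> F) (fun=> FG G)
  gerbe_j_aut (bundle_j A)
  (fun o w f f' => restricts f (eta w * (f' : star_aut (FG G)) * (eta o)^-1)%g)).
  move=> o' w' x f f' g g' ff gg.
  have -> : (eta x * siso_comp g' f' * (eta o')^-1 =
    (eta x * g' * (eta w')^-1) * (eta w' * f' * (eta o')^-1))%g.
    by rewrite !mulgA mulgVK.
  exact: restrictsM.
exact: gerbe_j_restricts.
Qed.

End BundleIso.
End Gerbe.
End NormalizerGerbes.

(** * Conjugation on G and uniqueness of the gerbe *)

Section FixedPointGerbes.
Variables (R : realType) (disp : Order.disp_t) (Delta : porderType disp).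
Variables (F : cstarAlgType R) (G : groupClosed (star_aut F)).
Implicit Types u v : star_aut F.

(** Equivalently, u^-1 v centralizes G. This is what transports of two gerbes over one [tau]
    share. *)
Definition same_conj u v :=
  forall x, x \in G -> (u * x * u^-1 = v * x * v^-1)%g.

Lemma same_conjM u v u' v' : u' \in normalizer G ->
  same_conj u v -> same_conj u' v' -> same_conj (u * u')%g (v * v')%g.
Proof.
move=> u'N uv uv' x xG; have := uv _ (normalizer_conj u'N xG).
by rewrite !invgM !mulgA => ->; rewrite -!(mulgA v) uv'// !mulgA.
Qed.

Lemma same_conjV u v : u \in normalizer G ->
  same_conj u v -> same_conj u^-1%g v^-1%g.
Proof.
move=> uN uv x xG; have uVN : u^-1%g \in normalizer G by rewrite gpredV.
have := uv _ (normalizer_conj uVN xG).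
rewrite !invgK !mulgA mulgV mul1g mulgK => xE.
by rewrite [in RHS]xE !mulgA mulVg mul1g mulgVK.
Qed.

Lemma same_conj_gj (tau : cochain Delta (norm_two_group G))
    (E E' : gerbe tau (@const_incl R disp Delta F G)) o w (h : (o <= w)%O) :
  same_conj (gj_aut E h) (gj_aut E' h).
Proof. by move=> x xG; rewrite !gj_conj// !mulgK. Qed.

Lemma same_conj_transport (tau : cochain Delta (norm_two_group G))
    (E E' : gerbe tau (@const_incl R disp Delta F G)) o w (p : poset_path o w) :
  same_conj (gerbe_transport E p) (gerbe_transport E' p).
Proof.
(* Membership in N(G) is carried through the induction because [same_conjM] needs it at each
   composition. *)
suff [] : gerbe_transport E p \in normalizer G /\
          same_conj (gerbe_transport E p) (gerbe_transport E' p) by [].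
apply: (@path_transport_rel disp Delta R (fun=> F) (fun=> F)
  (gerbe_j_aut E) (gerbe_j_aut E')
  (fun _ _ f f' => f \in normalizer G /\ same_conj f f')).
  move=> o' w' x f f' g g' [fN ff] [gN gg].
  by split; [apply: (@gpredM _ (normalizer G) g f)|apply: same_conjM ff].
move=> b; split; first exact: gerbe_j_normalizer.
rewrite /gerbe_j_aut /gerbe_j; case: pselect => [h|_]; first exact: same_conj_gj.
apply: (@same_conjM (gj_aut E (s1_le0 b))^-1%g (gj_aut E' (s1_le0 b))^-1%g
  (gj_aut E (s1_le1 b)) (gj_aut E' (s1_le1 b))).
- exact: gj_normalizer.
- by apply: same_conjV; [exact: gj_normalizer|exact: same_conj_gj].
- exact: same_conj_gj.
Qed.

Hypothesis hQG : QG_faithful G.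
Variables (a : Delta) (A : cstar_bundle (fun _ : Delta => FG G)).

Lemma gerbe_unique (tau : cochain Delta (norm_two_group G))
    (E E' : gerbe tau (@const_incl R disp Delta F G)) :
    poset_connected Delta ->
    bundle_iso_at a (centralizer G) A (fixed_bundle E) ->
    bundle_iso_at a (centralizer G) A (fixed_bundle E') ->
  gerbe_iso E E'.
Proof.
move=> conn [e [eP [z /[dup] zC /centralizer_normalizer zN zr]]].
move=> [e' [eP' [z' /[dup] zC' /centralizer_normalizer zN' zr']]].
have [p] := path_frame_exists a conn.
pose U o := gerbe_transport E (p o); pose W o := gerbe_transport E' (p o).
have UN o : U o \in normalizer G by exact: gerbe_transport_normalizer.
have WN o : W o \in normalizer G by exact: gerbe_transport_normalizer.
(* On fixed points U_o and W_o are the transport of [A] conjugated by [e] and [e']. The factor z'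
   z^-1 corrects the components at [a], so that [eta o] restricts to e'_o e_o^-1. *)
pose eta o : star_aut F := (W o * z' * z^-1 * (U o)^-1)%g.
have etaN o : eta o \in normalizer G by rewrite !gpredM// gpredV.
have etaR o : restricts (eta o) (e' o * (e o)^-1)%g.
  have := restrictsM (restrictsM (restrictsM
    (gerbe_transport_restricts eP' (p o)) zr') (restrictsV zr))
    (restrictsV (gerbe_transport_restricts eP (p o))).
  by rewrite !invgM !invgK !mulgA !mulgVK !mulgK.
have zz x : x \in G -> (z' * z^-1 * x = x * (z' * z^-1))%g.
  move=> xG; move/asboolP : zC => /(_ _ xG) zx; move/asboolP : zC' => /(_ _ xG).
  move=> zx'; rewrite [RHS]mulgA -zx' -!mulgA; congr (_ * _)%g.
  by apply: (mulgI z); rewrite !mulgA zx mulgV mul1g mulgK.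
have etaC o x : x \in G -> (eta o * x = x * eta o)%g.
  (* Pull x back along U_o to x'. Conjugation by W_o returns x' to the same x, and z' z^-1 commutes
     with x'. *)
  move=> xG; have [x' x'G xU] : exists2 x', x' \in G & x = (U o * x' * (U o)^-1)%g.
    exists ((U o)^-1 * x * (U o)^-1^-1)%g.
      by apply: normalizer_conj => //; rewrite gpredV.
    by rewrite invgK !mulgA mulgV mul1g mulgK.
  have zx' := zz x' x'G.
  have xW : (x = W o * x' * (W o)^-1)%g.
    by rewrite [LHS]xU; apply: same_conj_transport.
  rewrite [in LHS]xU [in RHS]xW /eta !mulgA !mulgVK; congr (_ * _)%g.
  by rewrite -!(mulgA (W o)) zx' !mulgA.
(* The intertwining equation forces this [beta]. It lies in G because its two factors have the same
   restriction, e'_w j e_o^-1 with j the map of [A] along [h]. *)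
exists eta, (fun o w h => gj_aut E' h * eta o * (eta w * gj_aut E h)^-1)%g.
split=> [o g y|o w h|o w h y].
- have := etaC o (val g) (valP g).
  by move=> /(congr1 (fun f : star_aut F => f y)).
- rewrite (@act_image_incl _ G).
  apply: (restricts_eq_mod hQG (f := (e' w * bj A h * (e o)^-1)%g)).
  + by rewrite gpredM// gj_normalizer.
  + by rewrite gpredM// gj_normalizer.
  + have := restrictsM (gj_restricts eP' h) (etaR o).
    by rewrite !mulgA mulgVK.
  + have := restrictsM (etaR w) (gj_restricts eP h).
    by rewrite !mulgA mulgVK.
- congr (gj_aut E' h (eta o _)).
  exact: (siso_funK (eta w * gj_aut E h)%g y).
Qed.

(** * Holonomies along frame loops, their lifts, and uniqueness of the connection *)

Definition frame_transport (p : path_frame a) o : star_aut (FG G) :=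
  path_transport (bundle_j A) (p o).
Definition frame_holonomy (p : path_frame a) b : star_aut (FG G) :=
  path_transport (bundle_j A) (frame_loop p b).

Lemma frame_holonomyE p b :
  frame_holonomy p b =
  ((frame_transport p (s1_d0 b))^-1 * (bundle_j A b : star_aut (FG G))
    * frame_transport p (s1_d1 b))%g.
Proof.
apply: star_iso_eq => y.
by rewrite /frame_holonomy /frame_loop path_transport_cat bundle_transport_rev.
Qed.

Lemma frame_holonomy_rev p b :
  frame_holonomy p (rev1 b) = (frame_holonomy p b)^-1%g.
Proof.
rewrite !frame_holonomyE bundle_j_rev.
move: (bundle_j A b : star_aut (FG G)) => j.
by rewrite !invgM invgK mulgA.
Qed.

(** Such a simplex has equal endpoints, so [bundle_j] goes up and back along the same inequality.
    This is the case where [odd_choice] prescribes the lift [1]. *)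
Lemma frame_holonomy_degenerate p b : rev1 b = b -> frame_holonomy p b = 1%g.
Proof.
move=> /rev1_fixed b01; rewrite frame_holonomyE.
case: b b01 => d0 d1 s le0 le1 /= e; subst d1.
apply: star_iso_eq => y /=.
by rewrite (bool_irrelevance le1 le0) !siso_funK.
Qed.

Lemma frame_holonomy_cocycle p c :
  (frame_holonomy p (s2_d0 c) * frame_holonomy p (s2_d2 c) =
   frame_holonomy p (s2_d1 c))%g.
Proof.
case: c => -[x w s0 h00 h01] [x' o s1 h10 h11] [w' o' s2 h20 h21] s k0 k1 k2.
move=> e00 e10 e11; simpl in *; subst x' w' o'; rewrite !frame_holonomyE.
have cancel_mid (f g h j k : star_aut (FG G)) :
    (f^-1 * j * g * (g^-1 * k * h) = f^-1 * (j * k) * h)%g.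
  by rewrite !mulgA mulgK.
rewrite [LHS]cancel_mid; congr (_ * _ * _)%g.
by apply: star_iso_eq; apply: bundle_j_cocycle k0 k1 k2.
Qed.

Lemma lift_holonomy (p : path_frame a) :
    (forall q : poset_path a a, in_QG (path_transport (bundle_j A) q)) ->
  exists u : simplex1 Delta -> star_aut F,
    (forall b, u b \in normalizer G /\ restricts (u b) (frame_holonomy p b)) /\
    (forall b, u (rev1 b) = (u b)^-1%g).
Proof.
move=> hA; apply: (odd_choice
  (P := fun b x => x \in normalizer G /\ restricts x (frame_holonomy p b))).
- move=> b x [xN xr].
  by rewrite gpredV frame_holonomy_rev; split=> //; exact: restrictsV.
- by move=> b bV; rewrite gpred1 frame_holonomy_degenerate.
- by move=> b; have [u uN ur] := hA (frame_loop p b); exists u.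
Qed.

Lemma cochain_unique (p : path_frame a) (tau tau' : cochain Delta (norm_two_group G))
    (E' : gerbe tau' (@const_incl R disp Delta F G)) :
    (forall q : poset_path a a, in_QG (path_transport (bundle_j A) q)) ->
    cocycle tau -> cocycle tau' ->
    (forall b, restricts (val (ch_u tau b)) (frame_holonomy p b)) ->
    associated E' (a := a) (incl_ext G) ->
    bundle_iso_at a (normalizer G) A (fixed_bundle E') ->
  cohomologous tau tau'.
Proof.
move=> hA tc tc' tr [_ [p' [q' [qu _ _ _ [v [h [uE _]]]]]]] [e [eP [z zN zr]]].
pose P := frame_transport p; pose P' := frame_transport p'.
(* P'_o^-1 P_o is the holonomy of a loop at [a], hence lifts to N(G); [n] performs the change of
   frame from [p] to [p']. *)
have nex o : exists n, n \in normalizer G /\ restricts n ((P' o)^-1 * P o)%g.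
  have [n nN nr] := hA (path_cat (path_rev (p' o)) (p o)); exists n; split=> //.
  by move: nr; rewrite path_transport_cat bundle_transport_rev.
have [n nP] := choice nex.
have vN o : val (v o) \in normalizer G.
  apply/normalizerP => x; have /normalizerP/(_ x) := valP (v o).
  by rewrite !act_image_incl.
have fex o : exists f : star_aut (FG G), restricts (val (v o)) f.
  by have [f] := normalizer_restricts (vN o); exists f.
have [f fP] := choice fex.
(* Three changes of gauge are composed: [n] changes the frame, [z] lifts the isomorphism at [a], and
   [v] passes from the based transports of [E'] to [tau']. *)
apply: (norm_cohomologous (v := fun o => (val (v o) * z * n o)%g)) => // [o|b].
  by rewrite !gpredM// (nP o).1.
have VN o : (val (v o) * z * n o)%g \in normalizer G.
  by rewrite !gpredM// (nP o).1.
have Vr o : restricts (val (v o) * z * n o)%g (f o * e a * ((P' o)^-1 * P o))%g.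
  exact: (restrictsM (restrictsM (fP o) zr) (nP o).2).
set d0 := s1_d0 b; set d1 := s1_d1 b.
have Vur := restrictsM (restrictsM (Vr d0) (tr b)) (restrictsV (Vr d1)).
apply: (restricts_eq_mod hQG _ _ _ Vur).
- exact: valP.
- by rewrite gpredM ?gpredV ?VN// gpredM ?VN// (valP (ch_u tau b)).
have hr : restricts (val (h b)) (1%g : star_aut (FG G)).
  by apply: restricts_sub; rewrite -act_image_incl; apply: valP.
have br := gerbe_transport_restricts eP (frame_loop p' b).
(* Both sides restrict to f_d0 e_a H e_a^-1 f_d1^-1, with H the holonomy of [A] in the frame [p'];
   the factor [h b] from G restricts to the identity. *)
have := restrictsM (restrictsM (restrictsM hr (fP d0)) br) (restrictsV (fP d1)).
have -> : (val (h b) * val (v d0) * gerbe_transport E' (frame_loop p' b)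
    * (val (v d1))^-1 = val (ch_u tau' b))%g.
  by have /(congr1 val) /= -> := uE b; rewrite qu.
by rewrite -/(frame_holonomy p' b) !frame_holonomyE mul1g !invgM !invgK !mulgA !mulgK.
Qed.

End FixedPointGerbes.

(** * Existence: the gerbe built from lifted holonomies *)

Section LiftedGerbe.
Variables (R : realType) (disp : Order.disp_t) (Delta : porderType disp).
Variables (F : cstarAlgType R) (G : groupClosed (star_aut F)).
Hypothesis hQG : QG_faithful G.
Variables (a : Delta) (A : cstar_bundle (fun _ : Delta => FG G)).
Variables (p : path_frame a) (u : simplex1 Delta -> star_aut F).
Hypothesis uN : forall b, u b \in normalizer G.
Hypothesis uR : forall b, restricts (u b) (frame_holonomy A p b).

(** The holonomies satisfy the cocycle identity exactly, so their lifts satisfy it modulo G. *)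
Lemma lift_cocycle c : (u (s2_d0 c) * u (s2_d2 c) * (u (s2_d1 c))^-1)%g \in G.
Proof.
apply: (restricts_eq_mod hQG _ _ _ (uR _)) => //; first by rewrite gpredM.
by rewrite -frame_holonomy_cocycle; apply: restrictsM.
Qed.

Definition lift_cochain : cochain Delta (norm_two_group G) :=
  norm_cochain uN lift_cocycle.

Lemma lift_gj_comp o w x (h : (o <= w)%O) (k : (w <= x)%O) (y : F) :
  @const_incl R disp Delta F G x (ch_g lift_cochain (nerve2 h k))
    (u (nerve1 (Order.POrderTheory.le_trans h k)) y) = u (nerve1 k) (u (nerve1 h) y).
Proof. by rewrite /= siso_funK. Qed.

Lemma lift_gj_act o w (h : (o <= w)%O) (g : tg_G (norm_two_group G)) (y : F) :
  u (nerve1 h) (@const_incl R disp Delta F G o g y) =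
  @const_incl R disp Delta F G w (tg_act (ch_u lift_cochain (nerve1 h)) g)
    (u (nerve1 h) y).
Proof. by rewrite /= siso_funK. Qed.

Definition lift_gerbe : gerbe lift_cochain (@const_incl R disp Delta F G) :=
  Gerbe lift_gj_comp lift_gj_act.

(** On fixed points [u b] is P_w^-1 j P_o, with P the frame transport and j the map of [A], so the
    inverse frame transports intertwine the two bundles. *)
Lemma lift_gerbe_bundle_iso :
  bundle_iso A (fixed_bundle lift_gerbe) (fun o => (frame_transport A p o)^-1%g).
Proof.
move=> o w h y; apply: val_inj => /=; rewrite -uR frame_holonomyE /=.
rewrite siso_invK; congr (val (siso_inv _ _ : FG G)).
by apply: (can_inj (siso_funK (bj A (Order.POrderTheory.lexx w)))); rewrite siso_invK bj_refl.
Qed.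

Lemma frame_transport_base : frame_transport A p a = 1%g.
Proof.
by rewrite /frame_transport pf_base; apply: star_iso_eq => y /=; rewrite siso_funK.
Qed.

(** The isomorphism with the fixed-point bundle is the identity at [a], so the based transports and
    the [u b] lift the same holonomies. They agree modulo G, and the constant gauge [1] suffices. *)
Lemma lift_gerbe_associated : associated lift_gerbe (a := a) (incl_ext G).
Proof.
split=> //; exists p.
have bN b : (based_j lift_gerbe p b : star_aut F) \in normalizer G.
  exact: (gerbe_transport_normalizer lift_gerbe (frame_loop p b)).
have bR b : restricts (based_j lift_gerbe p b : star_aut F) (frame_holonomy A p b).
  have := gerbe_transport_restricts lift_gerbe_bundle_iso (frame_loop p b).
  by rewrite frame_transport_base invg1 invg1 mulg1 mul1g.
have bN' b : (based_j lift_gerbe p b : star_aut F) \in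
    normalizer (act_image (@const_incl R disp Delta F G a)).
  apply/normalizerP => g; rewrite !(@act_image_incl _ G).
  by have /normalizerP := bN b.
have bK c : based_delta lift_gerbe p c \in act_image (@const_incl R disp Delta F G a).
  rewrite (@act_image_incl _ G).
  apply: (restricts_eq_mod hQG _ _ _ (bR _)) => //; first by rewrite gpredM.
  by rewrite -frame_holonomy_cocycle; apply: restrictsM.
exists (norm_cochain bN' bK).
have cq := norm_cochain_cocycle bN' bK.
have ct := push_incl_cocycle (norm_cochain_cocycle uN lift_cocycle).
split=> //.
apply: (norm_cohomologous (v := fun=> 1%g) cq ct) => [o|b].
  exact: gpred1.
rewrite mul1g invg1 mulg1 (@act_image_incl _ G).
exact: (restricts_eq_mod hQG (uN b) (bN b) (uR b) (bR b)).
Qed.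

End LiftedGerbe.

Theorem proposition4p1 (R : realType) (disp : Order.disp_t)
    (Delta : porderType disp) (hDelta : poset_connected Delta) (a : Delta)
    (F : cstarAlgType R) (G : groupClosed (star_aut F)) (hQG : QG_faithful G)
    (A : cstar_bundle (fun _ : Delta => FG G))
    (hA : forall p : poset_path a a, in_QG (path_transport (bundle_j A) p)) :
  exists tau : cochain Delta (norm_two_group G),
    [/\ twisted_connection tau,
      exists E : gerbe tau (@const_incl R disp Delta F G),
        [/\ associated E (a := a) (incl_ext G),
            bundle_iso_at a (centralizer G) A (fixed_bundle E) &
            forall E' : gerbe tau (@const_incl R disp Delta F G),
              associated E' (a := a) (incl_ext G) ->
              bundle_iso_at a (centralizer G) A (fixed_bundle E') ->
              gerbe_iso E E'] &
      forall (tau' : cochain Delta (norm_two_group G))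
             (E' : gerbe tau' (@const_incl R disp Delta F G)),
        twisted_connection tau' ->
        associated E' (a := a) (incl_ext G) ->
        bundle_iso_at a (normalizer G) A (fixed_bundle E') ->
        cohomologous tau tau'].
Proof.
have [p] := path_frame_exists a hDelta.
have [u [uP uV]] := lift_holonomy p hA.
have uN b := (uP b).1; have uR b := (uP b).2.
have tc := norm_cochain_cocycle uN (lift_cocycle hQG uN uR).
have isoE : bundle_iso_at a (centralizer G) A
    (fixed_bundle (lift_gerbe hQG uN uR)).
  exists (fun o => (frame_transport A p o)^-1%g).
  split; first exact: lift_gerbe_bundle_iso.
  exists 1%g; first by apply/asboolP => g _; rewrite mulg1 mul1g.
  by rewrite frame_transport_base invg1.
exists (lift_cochain hQG uN uR); split.
- by split=> // b; apply: val_inj; apply: uV.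
- exists (lift_gerbe hQG uN uR); split=> [|//|E' _ isoE'].
    exact: lift_gerbe_associated.
  exact: gerbe_unique isoE isoE'.
- move=> tau' E' [tc' _] assoc' isoE'.
  exact: (cochain_unique hQG hA tc tc' uR assoc' isoE').
Qed.
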